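(* Let $G$ be a split graph and fix a partition $V(G)=K\cup S$ with $K$ a clique, $S$ a stable set and $|S|=\alpha(G)$. Let $H$ be the $XY$-graph with $X=S$, $Y=K$ and edge set $\{xy\in E(G): x\in S,\ y\in K\}$. Then $H$ is an $XY$-graph with no isolates in $Y$, and $H$ is unbalanced if and only if $G$ is an unbalanced split graph (equivalently, $H$ is balanced if and only if $G$ is balanced).
   Context: A finite graph $G$ is a split graph if its vertex set can be partitioned as $K\cup S$ with $K$ a clique and $S$ a stable set (a $KS$-partition). With $\omega(G)$ the clique number and $\alpha(G)$ the independence number, a split graph is balanced if it has a $KS$-partition with $|K|=\omega(G)$ and $|S|=\alpha(G)$, and unbalanced otherwise. An $XY$-graph is a bipartite graph with a specified ordered bipartition $X\cup Y$ of its vertices (edges join $X$ to $Y$). A vertex of $Y$ is an isolate if it has no neighbor; a vertex of $X$ is universal if it is adjacent to every vertex of $Y$. An $XY$-graph with no isolates in $Y$ is unbalanced if $X$ contains a universal vertex, and balanced otherwise. *)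

(* Defs.v *)
From HB Require Import structures.
From mathcomp Require Import all_boot.

Set Implicit Arguments.
Unset Strict Implicit.
Unset Printing Implicit Defensive.

Section Graphs.

Variables (T : finType) (e : rel T).
Implicit Types (A K S X Y : {set T}) (x y u v : T).

Definition simple_graph : Prop := symmetric e /\ irreflexive e.

Definition clique A : bool :=
  [forall u in A, forall v in A, (u != v) ==> e u v].

Definition stable A : bool :=
  [forall u in A, forall v in A, ~~ e u v].

Definition clique_number : nat := \max_(A : {set T} | clique A) #|A|.

Definition independence_number : nat := \max_(A : {set T} | stable A) #|A|.

(* Either part may be empty, as usual for split graphs. *)
Definition KS_partition K S : Prop :=
  [/\ K :|: S = [set: T], [disjoint K & S], clique K & stable S].

Definition split_graph : Prop :=
  simple_graph /\ exists K S, KS_partition K S.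

Definition balanced_split : Prop :=
  split_graph /\
  exists K S, [/\ KS_partition K S, #|K| = clique_number
                & #|S| = independence_number].

Definition unbalanced_split : Prop :=
  split_graph /\
  ~ exists K S, [/\ KS_partition K S, #|K| = clique_number
                  & #|S| = independence_number].

Definition XY_graph X Y : Prop :=
  [/\ simple_graph, X :|: Y = [set: T], [disjoint X & Y]
    & forall u v, e u v ->
        (u \in X) && (v \in Y) || (u \in Y) && (v \in X)].

Definition isolate y : Prop := forall u, ~~ e y u.

Definition no_isolates_in Y : Prop := forall y, y \in Y -> ~ isolate y.

Definition universal_to Y x : Prop := forall y, y \in Y -> e x y.

(* (Un)balancedness is only defined for XY-graphs with no isolates in Y, so
   this condition is part of both definitions. *)
Definition XY_unbalanced X Y : Prop :=
  [/\ XY_graph X Y, no_isolates_in Y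
    & exists x, x \in X /\ universal_to Y x].

Definition XY_balanced X Y : Prop :=
  [/\ XY_graph X Y, no_isolates_in Y
    & ~ exists x, x \in X /\ universal_to Y x].

Definition cross_edges X Y : rel T :=
  fun u v => e u v && ((u \in X) && (v \in Y) || (u \in Y) && (v \in X)).

End Graphs.

(* Main.v *)
Require Import Defs.
From HB Require Import structures.
From mathcomp Require Import all_boot.

(** Maximality of [S] forbids a vertex of [K] without neighbours in [S], since
    such a vertex could be added to [S]. A vertex of [S] adjacent to all of [K]
    exists iff [K] is not a maximum clique: one direction adds the vertex to
    [K]; conversely a clique meets [S] in at most one vertex, so a clique larger
    than [K] is [K] plus one such vertex. Finally [G] is balanced iff [K] is
    itself a maximum clique, because all KS-partitions whose stable part has
    size [alpha(G)] have clique parts of equal size. *)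

Section SplitGraphs.

Set Implicit Arguments.
Unset Strict Implicit.

Variables (T : finType) (e : rel T).
Implicit Types (A K S : {set T}) (x y : T).

Lemma cliqueP A :
  reflect {in A &, forall u v, u != v -> e u v} (clique e A).
Proof.
apply: (iffP forall_inP) => [cA u v Au Av | cA u Au].
  by move/forall_inP: (cA u Au) => /(_ v Av)/implyP.
by apply/forall_inP => v Av; apply/implyP; apply: cA.
Qed.

Lemma stableP A : reflect {in A &, forall u v, ~~ e u v} (stable e A).
Proof.
apply: (iffP forall_inP) => [sA u v Au Av | sA u Au].
  by move/forall_inP: (sA u Au) => /(_ v Av).
by apply/forall_inP => v Av; apply: sA.
Qed.

Lemma leq_clique_number A : clique e A -> #|A| <= clique_number e.
Proof. by move=> cA; apply: (bigmax_sup A). Qed.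

Lemma leq_independence_number A : stable e A -> #|A| <= independence_number e.
Proof. by move=> sA; apply: (bigmax_sup A). Qed.

(** The empty set is a clique, so the maximum ranges over a nonempty family and is attained. *)
Lemma ex_maximum_clique : exists2 A, clique e A & #|A| = clique_number e.
Proof.
have c0 : clique e set0 by apply/cliqueP => u v; rewrite inE.
have [A cA maxA] := eq_bigmax_cond (fun A : {set T} => #|A|)
  (introT card_gt0P (ex_intro (fun A => A \in clique e) set0 c0)).
by exists A.
Qed.

Lemma card_KS_partition K S : KS_partition e K S -> #|K| + #|S| = #|T|.
Proof.
by case=> KST dKS _ _; rewrite -cardsT -KST cardsU disjoint_setI0 //
  cards0 subn0.
Qed.

Lemma clique_setU1 K x :
  symmetric e -> clique e K -> universal_to e K x -> clique e (x |: K).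
Proof.
move=> esym /cliqueP cK xK; apply/cliqueP => u v.
rewrite !inE => /predU1P[-> | Ku] /predU1P[-> | Kv]; first by rewrite eqxx.
- by move=> _; apply: xK.
- by move=> _; rewrite esym; apply: xK.
- exact: cK.
Qed.

Lemma stable_setU1 S y :
  simple_graph e -> stable e S -> {in S, forall u, ~~ e y u} ->
  stable e (y |: S).
Proof.
move=> [esym eirr] /stableP sS yS; apply/stableP => u v.
rewrite !inE => /predU1P[-> | Su] /predU1P[-> | Sv]; first by rewrite eirr.
- exact: yS.
- by rewrite esym; apply: yS.
- exact: sS.
Qed.

(** Two distinct common vertices would be both adjacent and non-adjacent. *)
Lemma card_clique_stable A S : clique e A -> stable e S -> #|A :&: S| <= 1.
Proof.
move=> /cliqueP cA /stableP sS; apply/card_le1_eqP => u v.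
rewrite !inE => /andP[Au Su] /andP[Av Sv]; apply/eqP.
by apply: contraNT (sS v u Sv Su); apply: cA.
Qed.

Lemma universal_clique_number K S :
  simple_graph e -> KS_partition e K S ->
  (exists x, x \in S /\ universal_to e K x) <-> #|K| < clique_number e.
Proof.
move=> [esym eirr] [KST dKS cK sS]; split=> [[x [Sx xK]] | ltK].
  have Kx : x \notin K by rewrite (disjointFl dKS Sx).
  by have := leq_clique_number (clique_setU1 esym cK xK); rewrite cardsU1 Kx.
have [A cA cardA] := ex_maximum_clique.
have AE : #|A| <= #|A :&: K| + #|A :&: S|.
  by rewrite -{1}[A]setIT -KST setIUr cardsU leq_subr.
have AS1 := card_clique_stable cA sS.
have AKK : #|A :&: K| <= #|K| by rewrite subset_leq_card ?subsetIr.
(* From [#|K| < #|A| <= #|A :&: K| + 1] it follows that [A :&: K] is at least as large as [K], hence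
   equal to it. *)
have KA : K \subset A.
  apply/setIidPr/eqP; rewrite eqEcard subsetIr /= -ltnS.
  rewrite -cardA in ltK; apply: leq_trans ltK (leq_trans AE _).
  by rewrite -addn1 leq_add2l.
(* The same count, now bounding [#|A :&: K|] by [#|K|], leaves room for a vertex of [A] in [S]. *)
have /card_gt0P[x] : 0 < #|A :&: S|.
  rewrite -(ltn_add2l #|K|) addn0; rewrite -cardA in ltK.
  by apply: leq_trans ltK (leq_trans AE _); rewrite leq_add2r.
rewrite inE => /andP[Ax Sx]; exists x; split=> // y Ky.
move/cliqueP: cA; apply=> //; first exact: (subsetP KA).
by apply: contraTneq Ky => <-; rewrite (disjointFl dKS Sx).
Qed.

(** Makes balancedness testable on the given partition: the sizes of the two parts always add up to
    [#|T|], so equal stable parts force equal clique parts. *)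
Lemma balanced_split_clique_number K S :
  KS_partition e K S -> #|S| = independence_number e ->
  (exists K' S', [/\ KS_partition e K' S', #|K'| = clique_number e
                   & #|S'| = independence_number e])
  <-> #|K| = clique_number e.
Proof.
move=> KS maxS; split=> [[K' [S' [KS' <- maxS']]] | maxK]; last by exists K, S.
apply/eqP; rewrite -(eqn_add2r #|S|) [in X in _ == X]maxS -maxS'.
by rewrite (card_KS_partition KS) (card_KS_partition KS').
Qed.

(** Otherwise [y |: S] would be stable with one vertex more than a maximum stable set, as [y] lies
    outside [S]. *)
Lemma maximum_stable_neighbor K S y :
  simple_graph e -> KS_partition e K S -> #|S| = independence_number e ->
  y \in K -> exists2 x, x \in S & e y x.
Proof.
move=> Gsimple [_ dKS _ sS] maxS Ky; apply/exists_inP.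
apply: contraT; rewrite negb_exists_in => /forall_inP yS.
have := leq_independence_number (stable_setU1 Gsimple sS yS).
by rewrite -maxS cardsU1 (disjointFr dKS Ky) ltnn.
Qed.

Lemma XY_graph_cross_edges K S :
  simple_graph e -> KS_partition e K S -> XY_graph (cross_edges e S K) S K.
Proof.
move=> [esym eirr] [KST dKS _ _]; split.
- split=> [u v | u]; rewrite /cross_edges ?eirr // esym orbC.
  by rewrite ![(_ \in K) && _]andbC.
- by rewrite setUC.
- by rewrite disjoint_sym.
- by move=> u v /andP[].
Qed.

Lemma universal_cross_edges K S x :
  x \in S -> universal_to (cross_edges e S K) K x <-> universal_to e K x.
Proof.
move=> Sx; split=> xK y Ky; first by case/andP: (xK y Ky).
by rewrite /cross_edges xK ?Sx ?Ky.
Qed.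

End SplitGraphs.

Theorem theorem3p5 (T : finType) (e : rel T) (K S : {set T})
  (Gsplit : split_graph e) (KSpart : KS_partition e K S)
  (Smax : #|S| = independence_number e) :
  let H := cross_edges e S K in
  [/\ XY_graph H S K,
      no_isolates_in H K,
      XY_unbalanced H S K <-> unbalanced_split e
    & XY_balanced H S K <-> balanced_split e].
Proof.
move=> H; have Gsimple := Gsplit.1.
have HXY : XY_graph H S K by apply: XY_graph_cross_edges.
have Hiso : no_isolates_in H K.
  move=> y Ky.
  have [x Sx eyx] := maximum_stable_neighbor Gsimple KSpart Smax Ky.
  by move/(_ x); rewrite /H /cross_edges eyx Ky Sx orbT.
have univH :
    (exists x, x \in S /\ universal_to H K x) <-> #|K| < clique_number e.
  apply: iff_trans (universal_clique_number Gsimple KSpart).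
  by split=> -[x [Sx xK]]; exists x; split=> //;
    apply/(universal_cross_edges e K Sx).
have balG := balanced_split_clique_number KSpart Smax.
(* With this bound, failing [#|K| = clique_number e] is the same as the strict inequality in
   [univH], so [univH] and [balG] describe complementary cases. *)
have leK : #|K| <= clique_number e.
  by case: KSpart => _ _ cK _; apply: leq_clique_number.
split=> //.
- split=> [[_ _ /univH ltK] | [_ nbal]].
    by split=> // /balG eqK; rewrite eqK ltnn in ltK.
  by split=> //; apply/univH; rewrite ltn_neqAle leK andbT; apply/eqP => /balG.
- split=> [[_ _ nuniv] | [_ /balG eqK]].
    split=> //; apply/balG/eqP; rewrite eqn_leq leK leqNgt.
    by apply/negP => /univH.
  by split=> // /univH; rewrite eqK ltnn.
Qed.
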